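(* Let $(A,\ast)$ be a Jacobi-Jordan algebra and $T:V\to A$ a relative Rota-Baxter operator with respect to a representation $(V,\rho)$. If a linear map $\mathcal{Z}:V\to A$ generates a linear deformation of $T$, then the bilinear map $\psi_{\mathcal{Z}}:V\times V\to V$ defined by $$\psi_{\mathcal{Z}}(u,v)=\rho(\mathcal{Z}u)v+\rho(\mathcal{Z}v)u,\quad\forall u,v\in V,$$ generates a linear deformation of the associated Jacobi-Jordan algebra $(V,\ast_T)$.
   Context: All vector spaces are finite dimensional over a field $\mathbb{K}$ of characteristic $0$; an algebra is a vector space with a bilinear product, not assumed associative. A Jacobi-Jordan algebra is an algebra $(A,\ast)$ with $x\ast y=y\ast x$ and $(x\ast y)\ast z+(y\ast z)\ast x+(z\ast x)\ast y=0$ for all $x,y,z$. A representation of $(A,\ast)$ is a pair $(V,\rho)$ with $\rho:A\to gl(V)$ linear such that $\rho(x\ast y)=-\rho(x)\rho(y)-\rho(y)\rho(x)$. A linear map $T:V\to A$ is a relative Rota-Baxter operator with respect to $(V,\rho)$ if $T(u)\ast T(v)=T(\rho(T(u))v+\rho(T(v))u)$ for all $u,v\in V$; in that case $(V,\ast_T)$ with $u\ast_T v:=\rho(Tu)v+\rho(Tv)u$ is a Jacobi-Jordan algebra. A linear map $\mathcal{Z}:V\to A$ generates a linear deformation of $T$ if $T+t\mathcal{Z}$ is a relative Rota-Baxter operator with respect to $(V,\rho)$ for all $t\in\mathbb{K}$. A bilinear map $\psi:B\times B\to B$ generates a linear deformation of a Jacobi-Jordan algebra $(B,\ast_B)$ if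 $(B,\mu_t)$ with $\mu_t(u,v)=u\ast_B v+t\psi(u,v)$ is a Jacobi-Jordan algebra for all $t\in\mathbb{K}$. *)

(* Defs.v *)
From mathcomp Require Import all_boot all_order all_algebra.

Set Implicit Arguments.
Unset Strict Implicit.
Unset Printing Implicit Defensive.

Import GRing.Theory.
Local Open Scope ring_scope.

Section JacobiJordan.

Variable K : fieldType.

Definition is_bilinear (U V W : vectType K) (f : U -> V -> W) : Prop :=
  bilinear_for *:%R *:%R f.

Definition is_jacobi_jordan (A : vectType K) (mul : A -> A -> A) : Prop :=
  [/\ is_bilinear mul,
      forall x y, mul x y = mul y x
    & forall x y z,
        mul (mul x y) z + mul (mul y z) x + mul (mul z x) y = 0].

Definition is_representation (A V : vectType K) (mul : A -> A -> A)
    (rho : 'Hom(A, 'End(V))) : Prop :=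
  forall x y,
    rho (mul x y) = - (rho x \o rho y)%VF - (rho y \o rho x)%VF.

Definition is_relative_rota_baxter (A V : vectType K) (mul : A -> A -> A)
    (rho : 'Hom(A, 'End(V))) (T : 'Hom(V, A)) : Prop :=
  forall u v, mul (T u) (T v) = T (rho (T u) v + rho (T v) u).

(* The product on [V] that is Jacobi-Jordan when [T] is a relative
   Rota-Baxter operator. *)
Definition induced_mul (A V : vectType K) (rho : 'Hom(A, 'End(V)))
    (T : 'Hom(V, A)) (u v : V) : V :=
  rho (T u) v + rho (T v) u.

Definition generates_operator_deformation (A V : vectType K)
    (mul : A -> A -> A) (rho : 'Hom(A, 'End(V))) (T Z : 'Hom(V, A)) : Prop :=
  forall t : K, is_relative_rota_baxter mul rho (T + t *: Z).

(* The case [t = 0] says that [mul] itself is a Jacobi-Jordan product. *)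
Definition generates_algebra_deformation (B : vectType K)
    (mul psi : B -> B -> B) : Prop :=
  is_bilinear psi /\
  forall t : K, is_jacobi_jordan (fun u v => mul u v + t *: psi u v).

End JacobiJordan.

(* Main.v *)
(* The product [u *_T v] is linear in [T], so deforming the product
   [*_T] along [psi_Z] by [t] gives exactly [*_(T + t Z)]. Each [T + t Z] is a
   relative Rota-Baxter operator, and such an operator always induces a
   Jacobi-Jordan product: in the cyclic sum of [(u *_T v) *_T w], the
   representation identity makes the six terms [rho (T x) (rho (T y) z)]
   appear once with each sign. *)
Require Import Defs.
From mathcomp Require Import all_boot all_order all_algebra.

Import GRing.Theory.
Local Open Scope ring_scope.

Section InducedProduct.

Variables (K : fieldType) (A V : vectType K).
Implicit Types (mul : A -> A -> A) (rho : 'Hom(A, 'End(V))) (T Z : 'Hom(V, A)).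

Lemma induced_mulC rho T u v : induced_mul rho T u v = induced_mul rho T v u.
Proof. exact: addrC. Qed.

Lemma induced_mul_bilinear rho T : is_bilinear (induced_mul rho T).
Proof.
(* Linearity in the second argument suffices: commutativity carries it to the first. *)
have linr u : linear (induced_mul rho T u).
  move=> a v w; rewrite /induced_mul !linearP /= add_lfunE scale_lfunE.
  by rewrite scalerDr addrACA.
split=> u; last exact: linr.
by move=> a v w; rewrite !(induced_mulC rho T _ u) linr.
Qed.

Lemma induced_mul_deform rho T Z (t : K) u v :
  induced_mul rho (T + t *: Z) u v =
    induced_mul rho T u v + t *: induced_mul rho Z u v.
Proof.
rewrite /induced_mul !(add_lfunE, scale_lfunE, linearD, linearZ) /=.
exact: addrACA.
Qed.

Lemma is_bilinear_ext (U : vectType K) (f g : U -> U -> U) :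
  f =2 g -> is_bilinear f -> is_bilinear g.
Proof.
by move=> fg [fl fr]; split=> u a v w; rewrite -!fg ?[LHS]fl ?[LHS]fr.
Qed.

(** Needed because the deformed product agrees with [induced_mul rho (T + t *: Z)] only
    pointwise. *)
Lemma is_jacobi_jordan_ext (B : vectType K) (f g : B -> B -> B) :
  f =2 g -> is_jacobi_jordan f -> is_jacobi_jordan g.
Proof.
move=> fg [fbil fC fJ]; split=> [|x y|x y z]; rewrite -?fg //.
exact: is_bilinear_ext fg fbil.
Qed.

Lemma induced_mul_jacobi_jordan mul rho T :
  is_representation mul rho -> is_relative_rota_baxter mul rho T ->
  is_jacobi_jordan (induced_mul rho T).
Proof.
move=> repr rb; split=> [|u v|u v w].
- exact: induced_mul_bilinear.
- exact: induced_mulC.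
have mul3E x y z : induced_mul rho T (induced_mul rho T x y) z =
    rho (T z) (rho (T x) y) + rho (T z) (rho (T y) x)
      - (rho (T x) (rho (T y) z) + rho (T y) (rho (T x) z)).
  (* Folding with [rb] turns [T] of the inner product into [mul (T x) (T y)], to which [repr]
     applies. *)
  rewrite /induced_mul -rb repr linearD /=.
  by rewrite !(add_lfunE, opp_lfunE, comp_lfunE) -opprD addrC.
rewrite !mul3E [X in X + _]addrACA -opprD addrACA -opprD.
apply/eqP; rewrite subr_eq0; apply/eqP.
(* The left side pairs the six terms by outermost operator, the right side by innermost vector. *)
by rewrite [LHS](AC (2*2*2) ((3*6)*(5*2)*(1*4))).
Qed.

End InducedProduct.

Theorem proposition3p23 (K : fieldType) (charK0 : [pchar K] =i pred0)
    (A V : vectType K) (mul : A -> A -> A) (rho : 'Hom(A, 'End(V)))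
    (T Z : 'Hom(V, A)) :
  is_jacobi_jordan mul ->
  is_representation mul rho ->
  is_relative_rota_baxter mul rho T ->
  generates_operator_deformation mul rho T Z ->
  generates_algebra_deformation (induced_mul rho T)
    (fun u v : V => rho (Z u) v + rho (Z v) u).
Proof.
(* [psi_Z] is [induced_mul rho Z] by definition, a formula bilinear for any linear [Z]. *)
move=> _ repr _ rb; split=> [|t]; first exact: induced_mul_bilinear rho Z.
apply: is_jacobi_jordan_ext; first exact: induced_mul_deform.
by apply: induced_mul_jacobi_jordan repr (rb t).
Qed.
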